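(* Let $(P,T)$ be a strong aut descendable autonomous system. Then $(P,T)$ is a partial order if and only if it has no induced minor isomorphic to $P_3$.
   Context: An autonomous system is a set $P$ together with a set $T$ of subsets of $P$, called autonomous sets, such that (i) $T$ is closed under arbitrary union (including the empty union, so $\emptyset\in T$), and (ii) (order property) for every $A\in T$ there is a total order $\le'$ of $A$ such that every $\le'$ downward closed subset of $A$ is in $T$. Standing assumption on the given system: $P$ itself is autonomous, i.e. $P\in T$. $(P,T)$ is strong aut descendable if the intersection of every nonempty chain (under inclusion) of autonomous sets is autonomous. $(P,T)$ is a partial order if there is a partial order $\le$ on $P$ such that $T$ is exactly the set of $\le$ downward closed subsets of $P$. For $C\subseteq P$, the contraction $P/C$ is the autonomous system with underlying set $P-C$ and autonomous sets $\{A-C : A\in T\}$. The deletion $P\backslash C$ is the autonomous system with underlying set $P-C$ and autonomous sets $\{B\subseteq P-C : B\in T\}$. A homomorphism $f$ from an autonomous system $(P,T_P)$ to an autonomous system $(Q,T_Q)$ is a function $f:P\to Q$ such that $f^{-1}(A)\in T_P$ for all $A\in T_Q$. A surjective homomorphism $f:(P,T_P)\to(Q,T_Q)$ is a quotient map if $T'\subseteq T_Q$ for every autonomous system $(Q,T')$ on the set $Q$ such that $f:(P,T_P)\to(Q,T')$ is a homomorphism; then $(Q,T_Q)$ is called a quotient of $(P,T_P)$. $Q'$ is an induced minor of $Q$ if there is a finite sequence $Q=Q_1,\ldots,Q_n=Q'$ of autonomous systems such that for each $1\le i<n$, $Q_{i+1}$ is $Q_i/C$ for some $C\subseteq Q_i$,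 or $Q_i\backslash C$ for some $C\subseteq Q_i$, or a quotient of $Q_i$. $P_3$ is the autonomous system on three distinct points $\{v_1,v_2,v_3\}$ whose autonomous sets are the sets $\{v_1,\ldots,v_i\}\cup\{v_k,\ldots,v_3\}$ with $0\le i\le 3$ and $1\le k\le 4$ (so all subsets except $\{v_2\}$). An isomorphism of autonomous systems is a bijection of underlying sets under which autonomous sets correspond exactly. *)

(* Defs.v *)
From Stdlib Require Import Relation_Operators.
From mathcomp Require Import all_boot.
From mathcomp Require Import boolp classical_sets.

Set Implicit Arguments.
Unset Strict Implicit.
Unset Printing Implicit Defensive.

Local Open Scope classical_set_scope.

Definition partial_order_on (X : Type) (A : set X) (R : X -> X -> Prop) : Prop :=
  [/\ forall x, A x -> R x x,
      forall x y, A x -> A y -> R x y -> R y x -> x = y &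
      forall x y z, A x -> A y -> A z -> R x y -> R y z -> R x z].

Definition total_order_on (X : Type) (A : set X) (R : X -> X -> Prop) : Prop :=
  partial_order_on A R /\ total_on A R.

Definition downward_closed_in (X : Type) (A : set X) (R : X -> X -> Prop)
    (D : set X) : Prop :=
  D `<=` A /\ forall x y, A x -> D y -> R x y -> D x.

Definition order_property (X : Type) (T : set (set X)) : Prop :=
  forall A, T A ->
    exists R : X -> X -> Prop, total_order_on A R /\
      forall D, downward_closed_in A R D -> T D.

Definition is_autonomous_system (X : Type) (T : set (set X)) : Prop :=
  (forall F : set (set X), F `<=` T -> T (\bigcup_(A in F) A)) /\
  order_property T.

(* The whole carrier need not be autonomous: deletions can lose this. *)
Record aut_system : Type := AutSystem {
  carrier :> Type;
  aut : set (set carrier);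
  autP : is_autonomous_system aut }.

Arguments aut : clear implicits.

Definition strong_aut_descendable (P : aut_system) : Prop :=
  forall F : set (set P), F !=set0 -> F `<=` aut P -> total_on F subset ->
    aut P (\bigcap_(A in F) A).

Definition is_partial_order (P : aut_system) : Prop :=
  exists R : P -> P -> Prop, partial_order_on [set: P] R /\
    forall A : set P, aut P A <-> downward_closed_in [set: P] R A.

Definition contraction_aut (X : Type) (T : set (set X)) (C : set X) :
    set (set (~` C)) :=
  [set (val : ~` C -> X) @^-1` A | A in T].

Definition deletion_aut (X : Type) (T : set (set X)) (C : set X) :
    set (set (~` C)) :=
  [set B : set (~` C) | T ((val : ~` C -> X) @` B)].

Arguments contraction_aut {X} T C _.
Arguments deletion_aut {X} T C _.

Lemma total_order_on_val (X : Type) (C A : set X) (R : X -> X -> Prop) :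
  total_order_on A R ->
  total_order_on ((val : ~` C -> X) @^-1` A) (fun x y => R (val x) (val y)).
Proof.
move=> [[rR aR tR] totR]; split; last by move=> x y; exact: totR.
split=> [x|x y Ax Ay xy yx|x y z].
- exact: rR.
- by apply: val_inj; apply: aR.
- exact: tR.
Qed.

Lemma contraction_autP (X : Type) (T : set (set X)) (C : set X) :
  is_autonomous_system T -> is_autonomous_system (contraction_aut T C).
Proof.
move=> [TU TO]; split=> [F FT|_ [A TA <-]].
- exists (\bigcup_(A in [set A | T A /\ F (val @^-1` A)]) A).
    by apply: TU => A [].
  apply/seteqP; split=> x /=; first by move=> [A [TA FA] Ax]; exists (val @^-1` A).
  by move=> [B FB Bx]; have [A TA AB] := FT _ FB; subst B; exists A.
- have [R [totR RT]] := TO _ TA.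
  exists (fun x y => R (val x) (val y)); split; first exact: total_order_on_val.
  move=> D [DA Dd].
  exists [set x | A x /\ exists2 y : ~` C, D y & R x (val y)].
    apply: RT; split=> [x []//|x y Ax [Ay [z Dz yz]] xy]; split=> //.
    exists z => //; have [[_ _ tR] _] := totR.
    by apply: (tR _ y) => //; exact: DA.
  apply/seteqP; split=> x /=; first by move=> [Ax [y Dy xy]]; exact: (Dd _ y).
  move=> Dx; split; first exact: DA.
  by exists x => //; have [[rR _ _] _] := totR; apply: rR; exact: DA.
Qed.

Lemma deletion_autP (X : Type) (T : set (set X)) (C : set X) :
  is_autonomous_system T -> is_autonomous_system (deletion_aut T C).
Proof.
move=> [TU TO]; split=> [F FT|B TB]; rewrite /deletion_aut /=.
- rewrite image_bigcup.
  rewrite (_ : \bigcup_(_ in _) _ =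
    \bigcup_(A in [set A | exists2 B, F B & A = val @` B]) A).
    by apply: TU => A [B FB ->]; exact: FT.
  apply/seteqP; split=> x; first by move=> [B FB Bx]; exists (val @` B) => //; exists B.
  by move=> [_ [B FB ->] Bx]; exists B.
- have [R [totR RT]] := TO _ TB.
  have BE : B = val @^-1` (val @` B).
    apply/seteqP; split=> x Bx /=; first by exists x.
    by case: Bx => y By /val_inj <-.
  exists (fun x y => R (val x) (val y)); split.
    by rewrite [X in total_order_on X]BE; exact: total_order_on_val.
  move=> D [DB Dd]; apply: RT; split=> [_ [x Dx <-]|_ _ [x Bx <-] [y Dy <-] xy].
    by exists x => //; exact: DB.
  by exists x => //; apply: (Dd _ y).
Qed.

Definition contraction (P : aut_system) (C : set P) : aut_system :=
  AutSystem (contraction_autP C (autP P)).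

Definition deletion (P : aut_system) (C : set P) : aut_system :=
  AutSystem (deletion_autP C (autP P)).

Definition is_hom (X Y : Type) (TX : set (set X)) (TY : set (set Y))
    (f : X -> Y) : Prop :=
  forall A, TY A -> TX (f @^-1` A).

Definition is_quotient_map (P Q : aut_system) (f : P -> Q) : Prop :=
  [/\ range f = [set: Q],
      is_hom (aut P) (aut Q) f &
      forall T' : set (set Q), is_autonomous_system T' ->
        is_hom (aut P) T' f -> T' `<=` aut Q].

Definition is_quotient (P Q : aut_system) : Prop :=
  exists f : P -> Q, is_quotient_map f.

Inductive minor_step (Q : aut_system) : aut_system -> Prop :=
| minor_contraction (C : set Q) : minor_step Q (contraction C)
| minor_deletion (C : set Q) : minor_step Q (deletion C)
| minor_quotient (Q' : aut_system) : is_quotient Q Q' -> minor_step Q Q'.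

Definition induced_minor (Q Q' : aut_system) : Prop :=
  clos_refl_trans aut_system minor_step Q Q'.

Definition isomorphic (P Q : aut_system) : Prop :=
  exists f : P -> Q, bijective f /\
    forall A : set P, aut P A <-> aut Q (f @` A).

(* The point v_j is the ordinal j - 1. *)
Definition P3_aut : set (set 'I_3) :=
  [set A | exists i k : nat, [/\ 0 <= i <= 3, 1 <= k <= 4 &
    A = [set v : 'I_3 | v.+1 <= i \/ k <= v.+1]]].

Lemma P3_autE (A : set 'I_3) : P3_aut A <-> A <> [set (inord 1 : 'I_3)].
Proof.
pose v0 := inord 0 : 'I_3; pose v1 := inord 1 : 'I_3; pose v2 := inord 2 : 'I_3.
have e0 : v0 = 0 :> nat by rewrite inordK.
have e1 : v1 = 1 :> nat by rewrite inordK.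
have e2 : v2 = 2 :> nat by rewrite inordK.
have vP (v : 'I_3) : [\/ v = v0, v = v1 | v = v2].
  have := ltn_ord v; case E : (val v) => [|[|[|//]]] _.
  - by apply: Or31; apply: val_inj; rewrite E /= e0.
  - by apply: Or32; apply: val_inj; rewrite E /= e1.
  - by apply: Or33; apply: val_inj; rewrite E /= e2.
split=> [[i [k [_ _ ->]]] E|nA].
- have : [set v : 'I_3 | v.+1 <= i \/ k <= v.+1] v1 by rewrite E.
  have : ~ [set v : 'I_3 | v.+1 <= i \/ k <= v.+1] v0.
    by rewrite E => /(congr1 val); rewrite /= e0 -/v1 e1.
  have : ~ [set v : 'I_3 | v.+1 <= i \/ k <= v.+1] v2.
    by rewrite E => /(congr1 val); rewrite /= e2 -/v1 e1.
  rewrite /= e0 e1 e2 => n2 n0 [i2|k2].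
    by apply: n0; left; exact: leq_trans i2.
  by apply: n2; right; exact: leq_trans k2 _.
- have H i k : i <= 3 -> 1 <= k <= 4 -> (A v0 <-> 1 <= i \/ k <= 1) ->
      (A v1 <-> 2 <= i \/ k <= 2) -> (A v2 <-> 3 <= i \/ k <= 3) -> P3_aut A.
    move=> i3 k4 h0 h1 h2; exists i, k; split=> //; apply/seteqP.
    by split=> v /=; case: (vP v) => ->; rewrite ?e0 ?e1 ?e2; tauto.
  case: (pselect (A v0)) => a0; case: (pselect (A v1)) => a1;
    case: (pselect (A v2)) => a2.
  + by apply: (H 3 4) => //; split=> [?|[]?] //; (by left) || right.
  + by apply: (H 2 4) => //; split=> [?|[]?] //; (by left) || right.
  + by apply: (H 1 3) => //; split=> [?|[]?] //; (by left) || right.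
  + by apply: (H 1 4) => //; split=> [?|[]?] //; (by left) || right.
  + by apply: (H 0 2) => //; split=> [?|[]?] //; (by left) || right.
  + exfalso; apply: nA; apply/seteqP; split=> v /=; last by move=> ->.
    by case: (vP v) => ->.
  + by apply: (H 0 3) => //; split=> [?|[]?] //; (by left) || right.
  + by apply: (H 0 4) => //; split=> [?|[]?] //; (by left) || right.
Qed.

Lemma P3_autP : is_autonomous_system P3_aut.
Proof.
set v1 : 'I_3 := inord 1.
have e1 : v1 = 1 :> nat by rewrite inordK.
split=> [F FT|A TA].
- apply/P3_autE => E.
  have [B FB Bv] : (\bigcup_(A in F) A) v1 by rewrite E.
  apply: (P3_autE B).1; first exact: FT.
  apply/seteqP; split=> [v Bv'|_ ->//].
  by rewrite -E; exists B.
- have lord (B : set 'I_3) : total_order_on B (fun x y => x <= y).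
    split; last by move=> x y _ _; apply/orP; exact: leq_total.
    split=> [//|x y _ _ xy yx|x y z _ _ _]; last exact: leq_trans.
    by apply/val_inj/anti_leq; rewrite xy yx.
  have gord (B : set 'I_3) : total_order_on B (fun x y => y <= x).
    split; last by move=> x y _ _; apply/orP; exact: leq_total.
    split=> [//|x y _ _ xy yx|x y z _ _ _ xy yz]; last exact: leq_trans xy.
    by apply/val_inj/anti_leq; rewrite xy yx.
  case: (pselect (exists2 v : 'I_3, A v & v < 1)) => [[v Av v1lt]|nlt].
    exists (fun x y => x <= y); split=> // D [DA Dd]; apply/P3_autE => E.
    have Dv : D v by apply: (Dd v v1) => //; rewrite ?E // e1 ltnW.
    by move: v1lt; move: Dv; rewrite E => ->; rewrite -/v1 e1.
  case: (pselect (exists2 v : 'I_3, A v & 1 < v)) => [[v Av v1gt]|ngt].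
    exists (fun x y => y <= x); split=> // D [DA Dd]; apply/P3_autE => E.
    have Dv : D v by apply: (Dd v v1) => //; rewrite ?E // e1 ltnW.
    by move: v1gt; move: Dv; rewrite E => ->; rewrite -/v1 e1.
  exists (fun x y => x <= y); split=> // D [DA _]; apply/P3_autE => E.
  apply: (P3_autE A).1 => //; apply/seteqP; split=> [v Av|v ->]; last first.
    by apply: DA; rewrite E.
  apply: val_inj; rewrite /= -/v1 e1.
  by case: (ltngtP v 1) => // h; [case: nlt|case: ngt]; exists v.
Qed.

Definition P3 : aut_system := AutSystem P3_autP.

(* Main.v *)
From Stdlib Require Import Relation_Operators.
Require Import Defs.
From mathcomp Require Import all_boot.
From mathcomp Require Import boolp classical_sets.
From mathcomp Require Import wochoice.

Local Open Scope classical_set_scope.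

(** Closure of the autonomous sets under binary intersection is inherited by
    induced minors: for a quotient f : P -> Q, the unions of sets A `&` B with
    A, B autonomous in Q form an autonomous system for which f is still a
    homomorphism, so they are autonomous in Q by maximality. Partial orders have
    this property and P3 does not.

    Conversely, descendability and Zorn's lemma put below every autonomous set
    containing x a minimal one. If it is always unique, these least sets define
    the partial order. Otherwise take two distinct minimal autonomous sets M and
    N containing x: deleting the complement of M `|` N, contracting
    (M `&` N) minus x, and identifying the points of M `\` N with each other,
    and likewise those of N `\` M, gives P3 with x as middle point. *)

(** * Well-orders and systems generated by unions *)

Lemma ex_well_order (T : Type) : exists R : T -> T -> Prop,
  total_order_on [set: T] R /\
  forall A : set T, A !=set0 -> exists2 m, A m & forall x, A x -> R m x.
Proof.
have [R wo'] := well_ordering_principle {classic T}.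
have wo : wo_chain R predT by move=> A _; exact: wo'.
have Rxx x : R x x by exact: wo_chain_reflexive wo _ isT.
have Rasym (x y : T) : R x y -> R y x -> x = y.
  by move=> xy yx; apply: (wo_chain_antisymmetric wo); rewrite ?xy.
have least (A : set T) : A !=set0 -> exists2 m, A m & forall x, A x -> R m x.
  move=> [a Aa]; have [||m [[/asboolP Am mA] _]] := wo [pred t | `[< A t >]].
  - by [].
  - by exists a; apply/asboolP.
  - by exists m => // x Ax; apply/mA/asboolP.
exists R; split=> //; split; last first.
  by move=> x y _ _; apply/orP; exact: (wo_chainW wo).
split=> [//|x y _ _|x y z _ _ _ xy yz]; first exact: Rasym.
(* Transitivity: if the least of x, y, z is y or z, antisymmetry merges it with its predecessor. *)
have [|m [->|[->|->]] mP] := least [set t | t = x \/ (t = y \/ t = z)].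
- by exists x; left.
- by apply: mP; right; right.
- by rewrite (Rasym x y) //; apply: mP; left.
- by rewrite -(Rasym y z) //; apply: mP; right; left.
Qed.

(** Given a union of members of [G], well-order the sets and index each point by the first member
    containing it. Order points lexicographically: by index, then by the order that [G] provides on
    that member. Downward closed sets are then unions of initial segments of members. *)
Lemma union_closure_autP (X : Type) (G : set (set X)) : order_property G ->
  is_autonomous_system [set \bigcup_(A in F) A | F in [set F | F `<=` G]].
Proof.
move=> Gord; split=> [H HG|_ [F FG <-]].
  (* Taking every member of [G] inside some B of [H] avoids choosing a family for each B. *)
  exists [set A | G A /\ exists2 B, H B & A `<=` B]; first by move=> A [].
  apply/seteqP; split=> x; first by move=> [A [_ [B HB AB]] Ax]; exists B => //; exact: AB.
  move=> [B HB Bx]; have [F FG FB] := HG _ HB.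
  move: Bx; rewrite -FB => -[A FA Ax]; exists A => //; split; first exact: FG.
  by exists B => //; rewrite -FB; exact: bigcup_sup.
have [le [[[le_refl le_asym le_trans] le_total] le_wf]] := ex_well_order (set X).
have /choice [ord ordP] : forall A, exists R, G A -> total_order_on A R /\
    forall D, downward_closed_in A R D -> G D.
  move=> A; have [/Gord[R RP]|nGA] := pselect (G A); first by exists R.
  by exists (fun _ _ => True).
have /choice [i iP] : forall x, exists A, (\bigcup_(B in F) B) x ->
    [/\ F A, A x & forall B, F B -> B x -> le A B].
  move=> x; have [[B FB Bx]|nx] := pselect ((\bigcup_(B in F) B) x).
    have [|A [FA Ax] Amin] := le_wf [set A | F A /\ A x]; first by exists B.
    by exists A => _; split=> // C FC Cx; exact: Amin.
  by exists set0.
set U := \bigcup_(B in F) B in iP *.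
pose R x y := le (i x) (i y) /\ (i x = i y -> ord (i x) x y).
have ordi x : U x -> total_order_on (i x) (ord (i x)) /\
    forall D, downward_closed_in (i x) (ord (i x)) D -> G D.
  by move=> /iP[/FG Gi _ _]; exact: ordP.
have iin x : U x -> i x x by case/iP.
have iP' x y : U x -> U y -> i x = i y -> i x y by move=> _ Uy ->; exact: iin.
exists R; split; first split; first split.
- move=> x Ux; have [[[orefl _ _] _] _] := ordi _ Ux.
  by split=> [|_]; [exact: le_refl|apply: orefl; exact: iin].
- move=> x y Ux Uy [xy oxy] [yx oyx]; have [[[_ oasym _] _] _] := ordi _ Ux.
  have e : i x = i y by exact: le_asym.
  apply: oasym; [exact: iin|exact: iP'|exact: oxy|].
  by rewrite e; exact: oyx.
- move=> x y z Ux Uy Uz [xy oxy] [yz oyz]; have [[[_ _ otrans] _] _] := ordi _ Ux.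
  split; first exact: le_trans yz.
  move=> e; have exy : i x = i y by apply: le_asym => //; rewrite e.
  apply: (otrans _ y); [exact: iin|exact: iP'|exact: iP'|exact: oxy|].
  by rewrite exy; apply: oyz; rewrite -exy.
- move=> x y Ux Uy; have [[_ ototal] _] := ordi _ Ux.
  have [e|ne] := pselect (i x = i y).
    have [xy|yx] := ototal x y (iin _ Ux) (iP' _ _ Ux Uy e).
    + by left; split=> //; rewrite e; exact: le_refl.
    + by right; split=> [|_]; rewrite -e //; exact: le_refl.
  have [xy|yx] := le_total (i x) (i y) I I; first by left; split.
  by right; split=> // /esym.
move=> D [DU Dd].
(* An element of [i x] has index at most [i x], so [D] contains the whole of
   its [ord (i x)]-lower segment in [i x], not just the part of index [i x]. *)
pose seg x := [set y | i x y /\ ord (i x) y x].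
exists [set seg x | x in D].
  move=> _ [x Dx <-]; have Ux := DU _ Dx; have [[[_ _ otrans] _] oG] := ordi _ Ux.
  apply: oG; split=> [y []//|y z iy [iz zx] yz]; split=> //.
  by apply: (otrans _ z) => //; exact: iin.
apply/seteqP; split=> [y [_ [x Dx <-] [iy yx]]|x Dx]; last first.
  have Ux := DU _ Dx; have [[[orefl _ _] _] _] := ordi _ Ux.
  exists (seg x); first by exists x.
  by split; [exact: iin|apply: orefl; exact: iin].
have Ux := DU _ Dx; have [Fi _ _] := iP _ Ux.
have Uy : U y by exists (i x).
apply: (Dd y x) => //; split; last by move=> ->.
by have [_ _] := iP _ Uy; apply.
Qed.

(** * Closure under binary intersection *)

Definition setI_stable {X : Type} (T : set (set X)) : Prop :=
  forall A B, T A -> T B -> T (A `&` B).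

Lemma partial_order_setI (P : aut_system) :
  is_partial_order P -> setI_stable (aut P).
Proof.
move=> [R [_ RP]] A B /RP[_ dA] /RP[_ dB]; apply/RP; split=> // x y _ [Ay By] xy.
by split; [apply: dA xy|apply: dB xy].
Qed.

Lemma quotient_setI (P Q : aut_system) :
  is_quotient P Q -> setI_stable (aut P) -> setI_stable (aut Q).
Proof.
move=> [f [_ hf fmax]] PI A B TA TB.
have [PU _] := autP P; have [_ Qord] := autP Q.
pose G := [set C | exists C1 C2, [/\ aut Q C1, aut Q C2 & C = C1 `&` C2]].
have Gord : order_property G.
  move=> _ [C1 [C2 [T1 T2 ->]]]; have [R [[[rR aR tR] totR] RT]] := Qord _ T1.
  exists R; split; first split; first split.
  - by move=> x [? _]; exact: rR.
  - by move=> x y [? _] [? _]; exact: aR.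
  - by move=> x y z [? _] [? _] [? _]; exact: tR.
  - by move=> x y [? _] [? _]; exact: totR.
  move=> D [D12 Dd].
  (* The downward closure of [D] in [C1] is autonomous, and meeting it with [C2] gives back [D]. *)
  exists [set x | C1 x /\ exists2 y, D y & R x y], C2; split=> //.
    apply: RT; split=> [x []//|x y C1x [C1y [z Dz yz]] xy]; split=> //.
    by exists z => //; apply: (tR _ y) => //; have [] := D12 _ Dz.
  apply/seteqP; split=> [x Dx|x [[C1x [y Dy xy]] C2x]]; last exact: (Dd x y).
  have [C1x C2x] := D12 _ Dx; split=> //; split=> //.
  by exists x => //; exact: rR.
apply: (fmax _ (union_closure_autP _ _ Gord)).
  move=> _ [F FG <-]; rewrite preimage_bigcup.
  rewrite (_ : \bigcup_(_ in _) _ = \bigcup_(C in [set f @^-1` C | C in F]) C).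
    by apply: PU => _ [C /FG[C1 [C2 [T1 T2 ->]]] <-]; apply: PI; exact: hf.
  by rewrite bigcup_image.
exists [set A `&` B]; last exact: bigcup_set1.
by move=> _ ->; exists A, B.
Qed.

Lemma minor_setI (P Q : aut_system) :
  induced_minor P Q -> setI_stable (aut P) -> setI_stable (aut Q).
Proof.
elim=> [{}P {}Q []|//|x y z _ IH1 _ IH2 /IH1/IH2//].
- move=> C PI _ _ [A TA <-] [B TB <-].
  by exists (A `&` B); [exact: PI|exact: preimage_setI].
- move=> C PI A B TA TB; rewrite /= /deletion_aut /=.
  suff -> : val @` (A `&` B) = val @` A `&` val @` B by exact: PI.
  apply/seteqP; split; first exact: sub_image_setI.
  by move=> _ [[a Aa <-] [b Bb /val_inj ba]]; exists a => //; split=> //; rewrite -ba.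
- by move=> Q'; exact: quotient_setI.
Qed.

Lemma isomorphic_setI (P Q : aut_system) :
  isomorphic P Q -> setI_stable (aut P) -> setI_stable (aut Q).
Proof.
move=> [f [[g fK gK] fP]] PI A B.
have fI C : f @` (f @^-1` C) = C.
  apply: image_preimage; apply/seteqP; split=> // y _.
  by exists (g y).
move=> TA TB; rewrite -[A `&` B]fI preimage_setI; apply/fP/PI; apply/fP; by rewrite fI.
Qed.

Lemma P3_not_setI : ~ setI_stable P3_aut.
Proof.
have e1 : (inord 1 : 'I_3) = 1 :> nat by rewrite inordK.
(* Ordinals start at 0, so these are {v_1, v_2} and {v_2, v_3}, which meet in {v_2}. *)
move=> /(_ [set v : 'I_3 | v < 2] [set v : 'I_3 | 0 < v]) H.
have /P3_autE[] : P3_aut ([set v : 'I_3 | v < 2] `&` [set v : 'I_3 | 0 < v]).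
  apply: H; apply/P3_autE => E.
    by have /(congr1 val) : [set inord 1] (ord0 : 'I_3) by [rewrite -E]; rewrite /= e1.
  by have /(congr1 val) : [set inord 1] (ord_max : 'I_3) by [rewrite -E]; rewrite /= e1.
apply/seteqP; split=> [v /= [v2 v0]|_ /= ->]; last by rewrite e1.
by apply: val_inj => /=; rewrite e1; case: (val v) v2 v0 => [|[|]].
Qed.

(** * Minimal autonomous sets containing a point *)

Definition minimal_aut (P : aut_system) (x : P) (M : set P) : Prop :=
  [/\ aut P M, M x & forall N, aut P N -> N x -> N `<=` M -> N = M].

(** [Zorn_bigcup] yields maximal sets from unions of chains, so it is applied to the part [B]
    removed from [A]; descendability handles the intersection of the remainders. *)
Lemma ex_minimal_aut (P : aut_system) (x : P) (A : set P) :
  strong_aut_descendable P -> aut P A -> A x ->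
  exists2 M, minimal_aut P x M & M `<=` A.
Proof.
move=> desc TA Ax.
have [|B [[TB nBx] Bmax]] := @Zorn_bigcup P [set B | aut P (A `\` B) /\ ~ B x].
  move=> F FP Ftot; split; last by move=> [B /FP[_]].
  have [->|/set0P[B0 FB0]] := eqVneq F set0.
    by rewrite bigcup_set0 setD0.
  rewrite (_ : A `\` _ = \bigcap_(C in [set A `\` B | B in F]) C).
    apply: desc; first by exists (A `\` B0), B0.
      by move=> _ [B /FP[TB _] <-].
    move=> _ _ [B FB <-] [C FC <-].
    by have [BC|CB] := Ftot _ _ FB FC; [right|left]; exact: setDS.
  apply/seteqP; split=> y.
    by move=> [Ay nFy] _ [B FB <-]; split=> // By; apply: nFy; exists B.
  move=> Fy; split=> [|[B FB By]].
    by have [] := Fy (A `\` B0) (ex_intro2 _ _ B0 FB0 erefl).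
  by have [_] := Fy (A `\` B) (ex_intro2 _ _ B FB erefl).
exists (A `\` B); last exact: subDsetl.
split=> // N TN Nx NAB; apply/seteqP; split=> // y [Ay nBy].
(* Removing the complement of [N] from [A] leaves [N], and this complement contains [B] strictly
   because of [y]. *)
apply: contrapT => nNy; apply: (Bmax (~` N)); last first.
  split; last by move/(_ Nx).
  by rewrite setDE setCK (setIidr _) // => z /NAB[].
by split=> [z Bz /NAB[]|/(_ y nNy)].
Qed.

(** In an order given by the order property, the points of [M] below [x] form an autonomous set
    containing [x], hence all of [M]. So [x] is the top, and dropping it leaves a downward closed
    set. *)
Lemma minimal_aut_remove (P : aut_system) (x : P) (M : set P) :
  minimal_aut P x M -> aut P (M `\ x).
Proof.
move=> [TM Mx Mmin].
have [R [[[rR aR tR] totR] RT]] := (autP P).2 _ TM.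
have top y : M y -> R y x.
  suff <- : [set z | M z /\ R z x] = M by case.
  apply: Mmin; [|by split; [|exact: rR]|by move=> z []].
  apply: RT; split=> [z []//|z t Mz [Mt tx] zt]; split=> //.
  exact: (tR _ t).
apply: RT; split=> [y []//|y z My [Mz nzx] yz]; split=> //= yx.
by apply: nzx => /=; apply: aR => //; [exact: top|rewrite -yx].
Qed.

Lemma unique_minimal_aut_partial_order (P : aut_system) :
  aut P [set: P] -> strong_aut_descendable P ->
  (forall (x : P) M N, minimal_aut P x M -> minimal_aut P x N -> M = N) ->
  is_partial_order P.
Proof.
move=> hP desc uniq.
have /choice [down downP] x : exists M, minimal_aut P x M.
  by have [M] := ex_minimal_aut _ _ _ desc hP (I : [set: P] x); exists M.
have downT x : aut P (down x) by case: (downP x).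
have downx x : down x x by case: (downP x).
have down_sub x A : aut P A -> A x -> down x `<=` A.
  move=> TA Ax; have [M minM MA] := ex_minimal_aut _ _ _ desc TA Ax.
  by rewrite (uniq _ _ _ (downP x) minM).
exists (fun x y => down y x); split; first split.
- by move=> x _.
- move=> x y _ _ xy yx; apply: contrapT => nxy.
  (* If y differs from x, then [down x] without x is autonomous and contains y, hence contains
     [down y], which contains x. *)
  have := down_sub y _ (minimal_aut_remove _ _ _ (downP x)).
  by move=> /(_ (conj yx (fun e => nxy (esym e)))) /(_ _ xy) [_ /(_ erefl)].
- by move=> x y z _ _ _ xy yz; exact: (down_sub y (down z)).
move=> A; split=> [TA|[_ dA]]; first by split=> // x y _ Ay; exact: down_sub.
rewrite (_ : A = \bigcup_(C in [set down x | x in A]) C).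
  by apply: (autP P).1 => _ [x _ <-].
apply/seteqP; split=> [x Ax|x [_ [y Ay <-]]]; last exact: dA.
by exists (down x) => //; exists x.
Qed.

(** * Extracting P3 from two minimal autonomous sets *)

Lemma two_minimal_aut_minor (P : aut_system) (x : P) (M N : set P) :
  minimal_aut P x M -> minimal_aut P x N -> M <> N -> induced_minor P P3.
Proof.
move=> minM minN neMN.
have TM' := minimal_aut_remove _ _ _ minM; have TN' := minimal_aut_remove _ _ _ minN.
have [[TM Mx Mmin] [TN Nx Nmin]] := (minM, minN).
have [PU _] := autP P.
pose D := @deletion P (~` (M `|` N)).
pose K : set D := [set p | [/\ M (val p), N (val p) & val p <> x]].
pose Q := @contraction D K.
have MND (p : D) : (M `|` N) (val p).
  by apply: contrapT => nMN; exact: (set_mem (valP p)).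
have inD p : (M `|` N) p -> p \in ~` ~` (M `|` N) by rewrite setCK inE.
pose e (z : Q) : P := val (val z).
have eMN z : M (e z) \/ N (e z) by exact: MND.
have eMNx z : M (e z) -> N (e z) -> e z = x.
  by move=> Mz Nz; apply: contrapT => nx; apply: (set_mem (valP z)).
have ex_e p : M p \/ N p -> (M p -> N p -> p = x) -> exists z, e z = p.
  move=> MNp pMN; have pD := inD p MNp.
  have zK : exist _ p pD \in ~` K by rewrite inE => -[/= Mp Np]; apply; exact: pMN.
  by exists (exist (fun d : D => d \in ~` K) _ zK).
have autQ (E : set Q) :
    aut Q E <-> exists A, [/\ aut P A, A `<=` M `|` N & E = e @^-1` A].
  split=> [[B TB <-]|[A [TA AMN ->]]].
    exists (val @` B); split=> //.
      by move=> _ [p _ <-]; exact: MND.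
    apply/seteqP; split=> z /=; first by exists (val z).
    by move=> [p Bp /val_inj <-].
  exists (val @^-1` A) => //; rewrite /= /deletion_aut /=.
  rewrite (_ : _ @` _ = A) //; apply/seteqP; split=> [|p Ap].
    exact: image_preimage_subset.
  by exists (exist _ p (inD p (AMN p Ap))).
pose v j : 'I_3 := inord j.
have vE j : j < 3 -> v j = j :> nat by move=> j3; rewrite /v inordK.
have neqv i j : i < 3 -> j < 3 -> i != j -> v i <> v j.
  by move=> i3 j3 /eqP ij /(congr1 val) /=; rewrite !vE.
(* The test for [x] comes first since [x] lies in both [M] and [N]; after the contraction no other
   point does. *)
pose f (z : Q) : 'I_3 :=
  if `[< e z = x >] then v 1 else if `[< M (e z) >] then v 0 else v 2.
have fx z : e z = x -> f z = v 1 by move=> ezx; rewrite /f asboolT.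
have fM z : M (e z) -> e z <> x -> f z = v 0.
  by move=> Mz zx; rewrite /f asboolF // asboolT.
have fN z : N (e z) -> e z <> x -> f z = v 2.
  by move=> Nz zx; rewrite /f asboolF // asboolF // => Mz; apply: zx; exact: eMNx.
(* One direction makes [f] a homomorphism, the other gives maximality of [P3_aut]. *)
have fP (B : set 'I_3) : aut Q (f @^-1` B) <-> P3_aut B.
  split=> [/autQ[A [TA AMN BE]]|/P3_autE nB].
    apply/P3_autE => B1; rewrite {}B1 in BE *.
    (* If the fibre of [v 1] came from an autonomous [A], then [A] would contain [x] and lie in both
       [M] and [N], so minimality would force M = A = N. *)
    have A_MN : A `<=` M `&` N.
      move=> p Ap; apply: contrapT => nMNp.
      have [z zp] : exists z, e z = p.
        by apply: ex_e; [exact: AMN|move=> Mp Np; case: nMNp].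
      have : (e @^-1` A) z by rewrite /= zp.
      rewrite -BE /= => fz1.
      have [px|px] := pselect (e z = x); first by apply: nMNp; rewrite -zp px.
      have [Mz|Nz] := eMN z.
        by move: fz1; rewrite fM //; exact: neqv.
      by move: fz1; rewrite fN //; exact: neqv.
    have Ax : A x.
      have [z zx] : exists z, e z = x by apply: ex_e; [left|].
      have : (f @^-1` [set v 1]) z by rewrite /= fx.
      by rewrite BE /= zx.
    apply: neMN; rewrite -(Mmin A TA Ax); last by move=> p /A_MN[].
    by apply: Nmin => // p /A_MN[].
  have Bv : B (v 1) -> B (v 0) \/ B (v 2).
    move=> B1; apply: contrapT => /not_orP[nB0 nB2]; apply: nB.
    apply/seteqP; split=> [j Bj|_ ->//].
    have : j = v 0 \/ j = v 1 \/ j = v 2.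
      have := ltn_ord j; case E : (val j) => [|[|[|//]]] _.
      - by left; apply: val_inj; rewrite /= vE.
      - by right; left; apply: val_inj; rewrite /= vE.
      - by right; right; apply: val_inj; rewrite /= vE.
    by move=> [jE|[//|jE]]; [case: nB0|case: nB2]; rewrite -jE.
  (* The preimage of [B] is covered by autonomous sets: [M] or [N] without [x] for an end point, and
     the whole of [M] or [N] when [v 1] is in [B] as well. By [Bv], [v 1] never occurs without an
     end point. *)
  pose F : set (set P) := [set C |
    [\/ C = M `\ x /\ B (v 0), C = N `\ x /\ B (v 2),
        C = M /\ (B (v 0) /\ B (v 1)) | C = N /\ (B (v 2) /\ B (v 1))]].
  apply/autQ; exists (\bigcup_(C in F) C); split.
  - by apply: PU => C [] [-> _].
  - by move=> p [C [] [-> _]]; [move=> [Mp _]; left|move=> [Np _]; right|left|right].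
  apply/seteqP; split=> z /=.
    have [ezx|zx] := pselect (e z = x).
      rewrite fx // ezx => B1; have [B0|B2] := Bv B1.
        by exists M => //; apply: Or43.
      by exists N => //; apply: Or44.
    have [Mz|Nz] := eMN z.
      by rewrite fM // => B0; exists (M `\ x) => //; apply: Or41.
    by rewrite fN // => B2; exists (N `\ x) => //; apply: Or42.
  have [ezx|zx] := pselect (e z = x).
    rewrite fx // => -[C [] [-> HB] Cz]; [| |by case: HB|by case: HB];
      by case: Cz => _ /(_ ezx).
  move=> [C [] [-> HB] Cz].
  - by rewrite fM //; case: Cz.
  - by rewrite fN //; case: Cz.
  - by rewrite fM //; case: HB.
  - by rewrite fN //; case: HB.
have ex_diff (M1 N1 : set P) : ~ M1 `<=` N1 -> exists2 p, M1 p & ~ N1 p.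
  move=> MN; apply: contrapT => nex; apply: MN => p Mp; apply: contrapT => Np.
  by apply: nex; exists p.
(* By minimality neither set includes the other; [p] and [q] witness that [f] reaches both end
   points. *)
have [p Mp nNp] : exists2 p, M p & ~ N p.
  by apply: ex_diff => MN; apply: neMN; exact: Nmin.
have [q Nq nMq] : exists2 q, N q & ~ M q.
  by apply: ex_diff => NM; apply/neMN/esym; exact: Mmin.
apply: (rt_trans _ _ _ D); first exact/rt_step/minor_deletion.
apply: (rt_trans _ _ _ Q); first exact/rt_step/minor_contraction.
apply/rt_step/minor_quotient; exists f; split.
- apply/seteqP; split=> // j _.
  have := ltn_ord j; case E : (val j) => [|[|[|//]]] _.
  + have [z ezp] : exists z, e z = p by apply: ex_e; [left|].
    exists z => //; rewrite fM ?ezp; [|by []|by move=> px; rewrite px in nNp].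
    by apply: val_inj; rewrite /= vE.
  + have [z ezx] : exists z, e z = x by apply: ex_e; [left|].
    by exists z => //; rewrite fx //; apply: val_inj; rewrite /= vE.
  + have [z ezq] : exists z, e z = q by apply: ex_e; [right|].
    exists z => //; rewrite fN ?ezq; [|by []|by move=> qx; rewrite qx in nMq].
    by apply: val_inj; rewrite /= vE.
- by move=> B TB; apply/fP.
- by move=> T' _ hT' B /hT' /fP.
Qed.

Theorem corollary27 (P : aut_system) (hP : aut P [set: P])
    (hdesc : strong_aut_descendable P) :
  is_partial_order P <->
  ~ (exists Q : aut_system, induced_minor P Q /\ isomorphic Q P3).
Proof.
split=> [poP [Q [PQ isoQ]]|nminor].
  apply: P3_not_setI; apply: (isomorphic_setI _ _ isoQ).
  by apply: (minor_setI _ _ PQ); exact: partial_order_setI.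
apply: unique_minimal_aut_partial_order => // x M N minM minN.
apply: contrapT => MN; apply: nminor; exists P3; split.
  exact: two_minimal_aut_minor minM minN MN.
exists id; split; first by exists id.
by move=> A; rewrite image_id.
Qed.
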